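(* Let $(D,{\cal A},\lambda)$ be an effective $\lambda$-model and let $\Lambda^{dec}_D=\{M\in\Lambda: M^D_\rho\in D^{dec}\text{ for all compact environments }\rho\}$. Then: (1) every variable $x$ belongs to $\Lambda^{dec}_D$; (2) if $M_1,\dots,M_k\in\Lambda^{dec}_D$ and $y$ is a variable then $yM_1\dots M_k\in\Lambda^{dec}_D$; (3) if $M\in\Lambda^{dec}_D$ then $\lambda x.M\in\Lambda^{dec}_D$. In particular, $\Lambda^{dec}_D$ contains all $\beta$-normal forms.
   Context: An effective domain is a triple $(D,\sqsubseteq_D,d)$ with $(D,\sqsubseteq_D)$ a Scott domain and $d:\mathbb{N}\to K(D)$ a surjective numeration of its compact elements such that ''$d_m,d_n$ have an upper bound'' and ''$d_n=d_m\sqcup d_k$'' are decidable. An element $v$ is r.e. (resp. decidable) if $\{n:d_n\sqsubseteq_D v\}$ is r.e. (resp. decidable); $D^{dec}$ is the set of decidable elements. Effective domains with continuous maps form a cartesian closed category, so function spaces are effective domains with r.e. elements. A weakly effective $\lambda$-model is $(D,{\cal A},\lambda)$ with $D$ an effective domain, ${\cal A}\in[D\to[D\to D]]$, $\lambda\in[[D\to D]\to D]$ r.e. elements with ${\cal A}\circ\lambda=id$; write $de$ for ${\cal A}(d)(e)$. It is effective if moreover (i) for $d\in K(D)$ and $e_1,\dots,e_n\in D^{dec}$, $de_1\dots e_n\in D^{dec}$; (ii) if $f\in[D\to D]$ is r.e. and $f(e)\in D^{dec}$ for all $e\in K(D)$, then $\lambda(f)\in D^{dec}$. Interpretation: $x_\rho=\rho(x)$,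 $(MN)_\rho=M_\rho N_\rho$, $(\lambda x.M)_\rho=\lambda(e\mapsto M_{\rho[x:=e]})$. An environment $\rho:Var\to D$ is compact if $\rho(x)\in K(D)$ for all $x$ and $\{x:\rho(x)\ne\bot_D\}$ is finite. *)

(* Defs.v *)
From HB Require Import structures.
From mathcomp Require Import all_boot all_order.
From mathcomp Require Import boolp classical_sets functions cardinality.
From Stdlib Require Import PeanoNat.
From Stdlib Require Cantor.

Set Implicit Arguments.
Unset Strict Implicit.
Unset Printing Implicit Defensive.

Import Order.TTheory.

Local Open Scope classical_set_scope.
Local Open Scope order_scope.

(* Total (general) recursive functions: minimization is only applied to
   regular functions, i.e. those having a zero for every value of the
   parameters. *)
Inductive recursive : forall k : nat, (k.-tuple nat -> nat) -> Prop :=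
| rec_zero k : recursive (fun _ : k.-tuple nat => 0%N)
| rec_succ : recursive (fun v : 1.-tuple nat => (thead v).+1)
| rec_proj k (i : 'I_k) : recursive (fun v : k.-tuple nat => tnth v i)
| rec_comp k m (f : m.-tuple nat -> nat) (g : 'I_m -> k.-tuple nat -> nat) :
    recursive f -> (forall i, recursive (g i)) ->
    recursive (fun v : k.-tuple nat => f [tuple g i v | i < m])
| rec_prim k (f : k.-tuple nat -> nat) (g : k.+2.-tuple nat -> nat) :
    recursive f -> recursive g ->
    recursive (fun v : k.+1.-tuple nat =>
      nat_rec (fun=> nat) (f [tuple of behead v])
        (fun n r => g [tuple of n :: r :: behead v]) (thead v))
| rec_min k (f : k.+1.-tuple nat -> nat)
    (reg : forall v : k.-tuple nat, exists n, f [tuple of n :: v] == 0%N) :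
    recursive f ->
    recursive (fun v : k.-tuple nat => ex_minn (reg v)).

Definition decidable_rel k (P : set (k.-tuple nat)) : Prop :=
  recursive (fun v => nat_of_bool `[< P v >]).

Definition decidable1 (P : nat -> Prop) : Prop :=
  decidable_rel [set v : 1.-tuple nat | P (nth 0%N v 0)].
Definition decidable2 (P : nat -> nat -> Prop) : Prop :=
  decidable_rel [set v : 2.-tuple nat | P (nth 0%N v 0) (nth 0%N v 1)].
Definition decidable3 (P : nat -> nat -> nat -> Prop) : Prop :=
  decidable_rel
    [set v : 3.-tuple nat | P (nth 0%N v 0) (nth 0%N v 1) (nth 0%N v 2)].

Definition re_set (A : set nat) : Prop :=
  A = set0 \/
  exists2 f : nat -> nat,
    recursive (fun v : 1.-tuple nat => f (thead v)) & A = range f.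

Section OrderNotions.
Context {d : Order.disp_t} {D : porderType d}.

Definition directed (A : set D) : Prop :=
  A !=set0 /\
  forall x y, A x -> A y -> exists z, [/\ A z, x <= z & y <= z].

Definition compact_elt (c : D) : Prop :=
  forall (A : set D) s, directed A -> isLub A s -> c <= s ->
  exists2 a, A a & c <= a.

End OrderNotions.

(* Countability of the compact elements is part of [isNumbered] below. *)
HB.mixin Record isScottDomain (d : Order.disp_t) D of Order.BPOrder d D := {
  directed_complete :
    forall A : set D, directed A -> exists s, isLub A s;
  bounded_complete :
    forall A : set D, has_ubound A -> exists s, isLub A s;
  algebraic :
    forall x : D, let K := [set c : D | compact_elt c /\ c <= x] in
      directed K /\ isLub K x
}.

#[short(type="scottDomainType")]
HB.structure Definition ScottDomain (d : Order.disp_t) :=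
  { D of Order.BPOrder d D & isScottDomain d D }.

HB.mixin Record isNumbered (d : Order.disp_t) D of ScottDomain d D := {
  num : nat -> D;
  range_num : range num = [set c : D | compact_elt c]
}.

#[short(type="numScottDomainType")]
HB.structure Definition NumScottDomain (d : Order.disp_t) :=
  { D of ScottDomain d D & isNumbered d D }.

HB.mixin Record isEffective (d : Order.disp_t) D of NumScottDomain d D := {
  decidable_ub :
    decidable2 (fun m n => has_ubound [set (num m : D); num n]);
  decidable_join :
    decidable3 (fun n m k => isLub [set (num m : D); num k] (num n))
}.

#[short(type="effDomainType")]
HB.structure Definition EffDomain (d : Order.disp_t) :=
  { D of NumScottDomain d D & isEffective d D }.

Definition re_elt {d} {D : numScottDomainType d} (v : D) : Prop :=
  re_set [set n | num n <= v].

Definition decidable_elt {d} {D : numScottDomainType d} (v : D) : Prop :=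
  decidable1 (fun n => num n <= v).

Section OrderTheory.
Context {d : Order.disp_t} {D : porderType d}.
Implicit Types (A : set D) (x y c : D).

Lemma isLub_unique A x y : isLub A x -> isLub A y -> x = y.
Proof. by move=> [ux lx] [uy ly]; apply/le_anti; rewrite lx // ly. Qed.

Lemma supremumE (x0 x : D) A : A !=set0 -> isLub A x -> supremum x0 A = x.
Proof.
move=> /set0P A0 [ux lx]; rewrite /supremum (negbTE A0).
case: xgetP => [y _ [uy ly]|/(_ x) []]; last by split.
by apply/le_anti; rewrite lx // ly.
Qed.

Lemma compact_lub (s : seq D) c :
  (forall x, x \in s -> compact_elt x) -> s != [::] -> isLub [set` s] c ->
  compact_elt c.
Proof.
move=> cs s0 [uc lc] A t [A0 dA] At ct.
suff [a Aa sa] : exists2 a, A a & forall x, x \in s -> x <= a.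
  by exists a => //; apply: lc => x; apply: sa.
have : forall x, x \in s -> x <= t.
  by move=> x xs; apply: le_trans ct; apply: uc.
elim: s cs {s0 uc lc} => [|x s IH] cs st; first by case: A0 => a; exists a.
case: IH => [y ys|y ys|a Aa sa].
- by apply: cs; rewrite inE ys orbT.
- by apply: st; rewrite inE ys orbT.
have xs : x \in x :: s by rewrite inE eqxx.
have [b Ab xb] := cs x xs A t (conj A0 dA) At (st x xs).
have [z [Az az bz]] := dA _ _ Aa Ab.
exists z => // y; rewrite inE => /predU1P[->|/sa ya]; first exact: le_trans bz.
exact: le_trans az.
Qed.

End OrderTheory.

Lemma compact_bot {d} {D : bPOrderType d} : compact_elt (\bot : D).
Proof. by move=> A s [[a Aa] _] _ _; exists a => //; exact: le0x. Qed.

Lemma num_compact {d} {D : numScottDomainType d} n : compact_elt (num n : D).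
Proof.
suff : range (num : nat -> D) (num n) by rewrite range_num.
by exists n.
Qed.

Definition scott_continuous {d d'} {D : porderType d} {E : porderType d'}
    (f : D -> E) : Prop :=
  forall A s, directed A -> isLub A s -> isLub (f @` A) (f s).

Record scott_fun {d d'} (D : porderType d) (E : porderType d') := ScottFun {
  scott_fun_val :> D -> E;
  scott_fun_continuous : scott_continuous scott_fun_val
}.

Notation "{ 'scott' D -> E }" := (scott_fun D E)
  (at level 0, D at level 98, E at level 99,
   format "{ 'scott'  D  ->  E }") : type_scope.

Lemma scott_mono {d d'} {D : porderType d} {E : porderType d'} (f : D -> E) :
  scott_continuous f -> {homo f : x y / x <= y}.
Proof.
move=> cf x y xy.
have dA : directed [set x; y].
  split; first by exists x; left.
  by move=> a b [->|->] [->|->]; exists y; split => //; right.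
have lA : isLub [set x; y] y.
  by split=> [a [->|->]//|b]; apply; right.
by have [u _] := cf _ _ dA lA; apply: u; exists x => //; left.
Qed.

Lemma directed_image {d d'} {D : porderType d} {E : porderType d'}
    (f : D -> E) (A : set D) :
  {homo f : x y / x <= y} -> directed A -> directed (f @` A).
Proof.
move=> mf [[a Aa] dA]; split; first by exists (f a), a.
move=> _ _ [x Ax <-] [y Ay <-]; have [z [Az xz yz]] := dA _ _ Ax Ay.
by exists (f z); split; [exists z|exact: mf|exact: mf].
Qed.

Section FunctionOrder.
Context {d d' : Order.disp_t} {D : porderType d} {E : porderType d'}.
Implicit Types f g h : {scott D -> E}.

Lemma scott_funP f g : (forall x, f x = g x) -> f = g.
Proof.
case: f g => [f cf] [g cg] /= /funext fg; case: _ / fg in cg *.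
by congr ScottFun; exact: Prop_irrelevance.
Qed.

HB.instance Definition _ := gen_eqMixin {scott D -> E}.
HB.instance Definition _ := gen_choiceMixin {scott D -> E}.

Definition scott_le f g : bool := `[< forall x, f x <= g x >].

Lemma scott_le_refl : reflexive scott_le.
Proof. by move=> f; apply/asboolP. Qed.

Lemma scott_le_anti : antisymmetric scott_le.
Proof.
move=> f g /andP[/asboolP fg /asboolP gf]; apply: scott_funP => x.
by apply/le_anti; rewrite fg gf.
Qed.

Lemma scott_le_trans : transitive scott_le.
Proof.
move=> g f h /asboolP fg /asboolP gh; apply/asboolP => x.
exact: le_trans (gh x).
Qed.

HB.instance Definition _ := Order.Le_isPOrder.Build d' {scott D -> E}
  scott_le_refl scott_le_anti scott_le_trans.

Lemma scott_leP f g : f <= g <-> forall x, f x <= g x.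
Proof. by split=> /asboolP. Qed.

Lemma scott_le_app f g x : f <= g -> f x <= g x.
Proof. by move=> /scott_leP. Qed.

End FunctionOrder.

Lemma const_continuous {d d'} {D : porderType d} {E : porderType d'} (e : E) :
  scott_continuous (fun _ : D => e).
Proof.
move=> A s [[a Aa] _] _; split=> [_ [? _ <-]//|b]; apply; by exists a.
Qed.

Section FunctionBottom.
Context {d d' : Order.disp_t} {D : porderType d} {E : bPOrderType d'}.

Definition scott_bot : {scott D -> E} := ScottFun (const_continuous \bot).

Lemma scott_bot_le (f : {scott D -> E}) : scott_bot <= f.
Proof. by apply/scott_leP => x; exact: le0x. Qed.

HB.instance Definition _ :=
  Order.hasBottom.Build d' {scott D -> E} scott_bot_le.

End FunctionBottom.

Section FunctionSpace.
Context {d d' : Order.disp_t} {D : numScottDomainType d}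
        {E : numScottDomainType d'}.
Implicit Types (F : set {scott D -> E}) (f g : {scott D -> E}).

Local Notation ev F x := [set f x | f in F].

Lemma pointwise_lub F (s : D -> E) : (forall x, isLub (ev F x) (s x)) ->
  exists2 h : {scott D -> E}, isLub F h & forall x, h x = s x.
Proof.
move=> ls; have cs : scott_continuous s.
  move=> A t dA At; split.
    move=> _ [a Aa <-]; apply: (ls a).2 => _ [f Ff <-].
    apply: le_trans ((ls t).1 _ (ex_intro2 _ _ f Ff erefl)).
    by apply: scott_mono (scott_fun_continuous f) _ _ _; apply: At.1.
  move=> b ub; apply: (ls t).2 => _ [f Ff <-].
  have [_] := scott_fun_continuous f dA At; apply => _ [a Aa <-].
  apply: (@le_trans _ _ (s a)); last by apply: ub; exists a.
  by apply: (ls a).1; exists f.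
exists (ScottFun cs) => //; split=> [f Ff|g ug].
  by apply/scott_leP => x; apply: (ls x).1; exists f.
by apply/scott_leP => x; apply: (ls x).2 => _ [f Ff <-]; apply: scott_le_app; exact: ug.
Qed.

Lemma directed_ev F x : directed F -> directed (ev F x).
Proof.
apply: (@directed_image _ _ _ _ (fun f : {scott D -> E} => f x)) => f g fg.
exact: scott_le_app.
Qed.

Lemma scott_lub F : (forall x, exists s, isLub (ev F x) s) ->
  exists2 h : {scott D -> E}, isLub F h & forall x, isLub (ev F x) (h x).
Proof.
move=> /choice[s ls]; have [h lh hs] := pointwise_lub ls.
by exists h => // x; rewrite hs.
Qed.

Lemma scott_directed_lub F : directed F ->
  exists2 h : {scott D -> E}, isLub F h & forall x, isLub (ev F x) (h x).
Proof.
by move=> dF; apply: scott_lub => x; apply/directed_complete/directed_ev.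
Qed.

Lemma scott_directed_complete F : directed F -> exists h, isLub F h.
Proof. by move=> /scott_directed_lub[h ? _]; exists h. Qed.

Lemma scott_bounded_complete F : has_ubound F -> exists h, isLub F h.
Proof.
move=> [g ug]; have [|h ? _] := @scott_lub F; last by exists h.
move=> x; apply: bounded_complete; exists (g x) => _ [f Ff <-].
by apply: scott_le_app; exact: ug.
Qed.

Definition step_val (m k : nat) (x : D) : E :=
  if (num m : D) <= x then num k else \bot.

Lemma step_continuous m k : scott_continuous (step_val m k).
Proof.
move=> A s dA lA; split.
  move=> _ [a Aa <-]; rewrite /step_val; case: ifP => [ma|_]; last exact: le0x.
  by rewrite (le_trans ma) //; exact: lA.1.
move=> b ub; rewrite {1}/step_val; case: ifPn => [ms|_]; last exact: le0x.
have [a Aa ma] := num_compact dA lA ms.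
by apply: ub; exists a => //; rewrite /step_val ma.
Qed.

Definition step (m k : nat) : {scott D -> E} := ScottFun (step_continuous m k).

Lemma step_leP m k f : step m k <= f <-> num k <= f (num m).
Proof.
split=> [/scott_leP/(_ (num m))|kf]; first by rewrite /= /step_val lexx.
apply/scott_leP => x /=; rewrite /step_val; case: ifP => [mx|_]; last exact: le0x.
by apply: le_trans kf _; apply: scott_mono (scott_fun_continuous f) _ _ mx.
Qed.

Lemma step_compact m k : compact_elt (step m k).
Proof.
move=> F h dF lF /step_leP kh; have [h' lF' lx] := scott_directed_lub dF.
rewrite (isLub_unique lF lF') in kh.
have [_ [f Ff <-] kf] := num_compact (directed_ev (num m) dF) (lx _) kh.
by exists f => //; apply/step_leP.
Qed.

(* [n] is read as the canonical index of the finite set of those [i] for which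
   the [i]-th binary digit of [n] is 1, and each such [i] as a Cantor pair
   [(m, k)]. *)
Definition step_set (n : nat) : set {scott D -> E} :=
  [set step (Cantor.of_nat i).1 (Cantor.of_nat i).2 |
    i in [set i | Nat.testbit n i]].

(* The join of the step functions indexed by [n]; it is \bot if [n = 0] or if
   these step functions have no upper bound. *)
Definition scott_num (n : nat) : {scott D -> E} := supremum \bot (step_set n).

Lemma step_set_seq n : exists s : seq {scott D -> E},
  step_set n = [set` s] /\ forall f, f \in s -> compact_elt f.
Proof.
exists [seq step (Cantor.of_nat i).1 (Cantor.of_nat i).2 |
         i <- iota 0 n & Nat.testbit n i]; split; last first.
  by move=> f /mapP[i _ ->]; exact: step_compact.
apply/seteqP; split=> [_ [i /= ni <-]|f /= /mapP[i]].
  apply: map_f; rewrite mem_filter ni mem_iota /= add0n.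
  rewrite ltnNge; apply/negP => /ssrnat.leP ni'.
  have : Nat.testbit n i = false.
    case: n ni ni' => [|n]; first by rewrite Nat.bits_0.
    move=> _ ni'; apply: Nat.bits_above_log2.
    by apply: Nat.lt_le_trans ni'; apply: Nat.log2_lt_lin; apply: Nat.lt_0_succ.
  by rewrite ni.
by rewrite mem_filter => /andP[ni _] ->; exists i.
Qed.

Lemma scott_num_compact n : compact_elt (scott_num n).
Proof.
rewrite /scott_num /supremum; case: ifPn => [_|/set0P n0]; first exact: compact_bot.
case: xgetP => [h _ lh|_]; last exact: compact_bot.
have [s [sn cs]] := step_set_seq n; rewrite sn in lh n0.
apply: compact_lub lh => //.
by apply/eqP => s0; case: n0 => f /=; rewrite s0.
Qed.

Lemma scott_num_unbounded n : ~ has_ubound (step_set n) -> scott_num n = \bot.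
Proof.
move=> nN; rewrite /scott_num /supremum; case: ifP => // _.
by case: xgetP => // h _ [uh _]; case: nN; exists h.
Qed.

Lemma scott_num_lub n f : ubound (step_set n) f -> isLub (step_set n) (scott_num n).
Proof.
move=> uf; have [h lh] := @scott_bounded_complete (step_set n) (ex_intro _ f uf).
have [n0|/set0P n0] := eqVneq (step_set n) set0.
  rewrite /scott_num /supremum n0 eqxx; split=> // g _; exact: le0x.
by rewrite /scott_num (supremumE _ n0 lh).
Qed.

Lemma step_num m k : exists n, scott_num n = step m k.
Proof.
exists (Nat.setbit 0 (Cantor.to_nat (m, k))).
have -> : scott_num (Nat.setbit 0 (Cantor.to_nat (m, k))) =
          supremum \bot [set step m k].
  rewrite /scott_num; congr supremum; apply/seteqP; split=> f /=.
    move=> [i /= bi <-]; have : Cantor.to_nat (m, k) = i.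
      apply: contrapT => ne.
      by rewrite Nat.setbit_neq // Nat.bits_0 in bi.
    by move=> <-; rewrite Cantor.cancel_of_to.
  move=> ->; exists (Cantor.to_nat (m, k)); last by rewrite Cantor.cancel_of_to.
  by rewrite /= Nat.setbit_eq.
by apply: supremumE; [exists (step m k)|split=> [g ->|g]//; apply].
Qed.

Lemma directed_scott_num f :
  let N := [set g | range scott_num g /\ g <= f] in directed N /\ isLub N f.
Proof.
move=> N; split; last split.
- split.
    exists (scott_num 0); split; first by exists 0%N.
    rewrite /scott_num (_ : step_set 0 = set0).
      by rewrite /supremum eqxx; exact: le0x.
    by apply/seteqP; split=> // g [i /=]; rewrite Nat.bits_0.
  move=> _ _ [[m _ <-] mf] [[n _ <-] nf].
  have [m0|mN] := pselect (has_ubound (step_set m)); last first.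
    exists (scott_num n); split; [by split=> //; exists n| |by []].
    by rewrite scott_num_unbounded //; exact: le0x.
  have [n0|nN] := pselect (has_ubound (step_set n)); last first.
    exists (scott_num m); split; [by split=> //; exists m|by []|].
    by rewrite (scott_num_unbounded nN); exact: le0x.
  case: m0 => m0 /scott_num_lub[um lm]; case: n0 => n0 /scott_num_lub[un ln].
  have uf : ubound (step_set (Nat.lor m n)) f.
    move=> _ [i /= + <-]; rewrite Nat.lor_spec => /orP[mi|ni].
      by apply: le_trans mf; apply: um; exists i.
    by apply: le_trans nf; apply: un; exists i.
  have [u l] := scott_num_lub uf.
  exists (scott_num (Nat.lor m n)); split.
  + by split; [exists (Nat.lor m n)|exact: l].
  + by apply: lm => _ [i /= mi <-]; apply: u; exists i; rewrite //= Nat.lor_spec mi.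
  + apply: ln => _ [i /= ni <-]; apply: u; exists i; rewrite //= Nat.lor_spec ni.
    exact: orbT.
- by move=> g [].
- move=> g ug; apply/scott_leP => x.
  have [dx lx] := algebraic x.
  have [_] := scott_fun_continuous f dx lx; apply => _ [a [ca ax] <-].
  apply: (@le_trans _ _ (g a)); last first.
    exact: scott_mono (scott_fun_continuous g) _ _ ax.
  have [_] := (algebraic (f a)).2; apply=> b [cb bfa].
  have : range (num : nat -> D) a by rewrite range_num.
  move=> [m _ ma]; have : range (num : nat -> E) b by rewrite range_num.
  move=> [k _ kb]; subst a b; have [n nE] := step_num m k.
  by apply/step_leP; apply: ug; split; [exists n|apply/step_leP].
Qed.

Lemma range_scott_num : range scott_num = [set c | compact_elt c].
Proof.
apply/seteqP; split=> [_ [n _ <-]|f /= cf]; first exact: scott_num_compact.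
have [dN lN] := directed_scott_num f.
have [g [ng gf] fg] := cf _ _ dN lN (lexx f).
by rewrite (_ : f = g) //; apply/le_anti; rewrite fg gf.
Qed.

Lemma scott_algebraic f :
  let K := [set c | compact_elt c /\ c <= f] in directed K /\ isLub K f.
Proof. by have := directed_scott_num f; rewrite range_scott_num. Qed.

HB.instance Definition _ := isScottDomain.Build d' {scott D -> E}
  scott_directed_complete scott_bounded_complete scott_algebraic.

HB.instance Definition _ := isNumbered.Build d' {scott D -> E} range_scott_num.

End FunctionSpace.

Record weakly_effective_model {d} (D : effDomainType d) := WeaklyEffectiveModel {
  app : {scott D -> {scott D -> D}};
  lam : {scott {scott D -> D} -> D};
  app_re : re_elt app;
  lam_re : re_elt lam;
  app_lam : forall f, app (lam f) = f
}.

Definition effective_model {d} {D : effDomainType d}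
    (L : weakly_effective_model D) : Prop :=
  (forall (c : D) (n : nat) (e : n.-tuple D),
     compact_elt c -> (forall i, decidable_elt (tnth e i)) ->
     decidable_elt (foldl (fun a b => app L a b) c e)) /\
  (forall f : {scott D -> D},
     re_elt f -> (forall e, compact_elt e -> decidable_elt (f e)) ->
     decidable_elt (lam L f)).

(* Raw terms with named variables; they are not quotiented by
   alpha-conversion, under which the interpretation is invariant. *)
Inductive term : Type :=
| Var of nat
| App of term & term
| Lam of nat & term.

Inductive subterm (N : term) : term -> Prop :=
| sub_refl : subterm N N
| sub_appl M P : subterm N M -> subterm N (App M P)
| sub_appr M P : subterm N P -> subterm N (App M P)
| sub_lam x M : subterm N M -> subterm N (Lam x M).

Definition beta_normal (M : term) : Prop :=
  forall x P Q, ~ subterm (App (Lam x P) Q) M.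

Definition env {d} (D : porderType d) : Type := nat -> D.

Definition upd {d} {D : porderType d} (rho : env D) (x : nat) (e : D) : env D :=
  fun y => if y == x then e else rho y.

(* [e |-> F (rho[x := e])] is continuous for every [rho] and [x]; this is
   carried along the interpretation so that [lam] can be applied. *)
Definition continuous_in_env {d} {D : porderType d} (F : env D -> D) : Prop :=
  forall rho x, scott_continuous (fun e => F (upd rho x e)).

Section Interpretation.
Context {d : Order.disp_t} {D : effDomainType d} (L : weakly_effective_model D).

Record semantics := Semantics {
  sem_val :> env D -> D;
  sem_continuous : continuous_in_env sem_val
}.

Lemma var_continuous x : continuous_in_env (fun rho : env D => rho x).
Proof.
move=> rho y; rewrite /upd; case: (x == y); last exact: const_continuous.
by move=> A s dA lA; rewrite image_id.
Qed.

Lemma app_continuous (F G : semantics) :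
  continuous_in_env (fun rho => app L (F rho) (G rho)).
Proof.
move=> rho x A s dA lA.
pose f e := F (upd rho x e); pose g e := G (upd rho x e).
have cf : scott_continuous f by exact: sem_continuous.
have cg : scott_continuous g by exact: sem_continuous.
have mA e e' a a' : e <= e' -> a <= a' -> app L e a <= app L e' a'.
  move=> ee aa; apply: (@le_trans _ _ (app L e a')).
    exact: scott_mono (scott_fun_continuous (app L e)) _ _ aa.
  exact/scott_le_app/(scott_mono (scott_fun_continuous (app L))).
split=> [_ [a Aa <-]|b ub].
  by apply: mA; [apply: (scott_mono cf)|apply: (scott_mono cg)]; exact: lA.1.
have dfA := directed_image (scott_mono cf) dA.
have dgA := directed_image (scott_mono cg) dA.
have lf := scott_fun_continuous (app L) dfA (cf _ _ dA lA).
have dafA := directed_image (scott_mono (scott_fun_continuous (app L))) dfA.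
have [h lh lx] := scott_directed_lub dafA.
have -> : app L (F (upd rho x s)) = h by exact: isLub_unique lf lh.
apply: (lx _).2 => _ [_ [_ [a Aa <-] <-] <-].
have [_] := scott_fun_continuous (app L (f a)) dgA (cg _ _ dA lA).
apply=> _ [_ [a' Aa' <-] <-].
have [c [Ac ac a'c]] := dA.2 _ _ Aa Aa'.
apply: (@le_trans _ _ (app L (f c) (g c))); last by apply: ub; exists c.
by apply: mA; [exact: (scott_mono cf)|exact: (scott_mono cg)].
Qed.

Definition abs_fun (F : semantics) (x : nat) (rho : env D) : {scott D -> D} :=
  ScottFun (sem_continuous F rho x).

Lemma updC (rho : env D) x y e e' : x != y ->
  upd (upd rho x e) y e' = upd (upd rho y e') x e.
Proof.
move=> xy; apply/funext => z; rewrite /upd.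
by case: (eqVneq z y) => // ->; rewrite eq_sym (negbTE xy).
Qed.

Lemma updK (rho : env D) x e e' : upd (upd rho x e) x e' = upd rho x e'.
Proof. by apply/funext => z; rewrite /upd; case: eqVneq. Qed.

Lemma lam_continuous (F : semantics) (x : nat) :
  continuous_in_env (fun rho => lam L (abs_fun F x rho)).
Proof.
move=> rho y.
have cabs : scott_continuous (fun e => abs_fun F x (upd rho y e)).
  move=> A s dA lA.
  have lp e : scott_continuous (fun a => F (upd (upd rho y a) x e)).
    have [<-|yx] := eqVneq y x.
      rewrite (_ : (fun a => _) = fun=> F (upd rho y e)).
        exact: const_continuous.
      by apply/funext => a; rewrite updK.
    rewrite (_ : (fun a => _) = fun a => F (upd (upd rho x e) y a)).
      exact: sem_continuous.
    by apply/funext => a; rewrite updC.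
  have [h lh hE] := @pointwise_lub _ _ D D
    [set abs_fun F x (upd rho y a) | a in A]
    (fun e => F (upd (upd rho y s) x e))
    (fun e => ltac:(rewrite image_comp; exact: (lp e A s dA lA))).
  by rewrite (_ : abs_fun _ _ _ = h) //; apply: scott_funP => e; rewrite hE.
move=> A s dA lA.
have := scott_fun_continuous (lam L)
  (directed_image (scott_mono cabs) dA) (cabs _ _ dA lA).
by rewrite image_comp.
Qed.

Fixpoint interp_sem (M : term) : semantics :=
  match M with
  | Var x => Semantics (var_continuous x)
  | App M N => Semantics (app_continuous (interp_sem M) (interp_sem N))
  | Lam x M => Semantics (lam_continuous (interp_sem M) x)
  end.

Definition interp (M : term) (rho : env D) : D := interp_sem M rho.

Lemma interp_continuous M rho x :
  scott_continuous (fun e => interp M (upd rho x e)).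
Proof. exact: sem_continuous. Qed.

Lemma interp_var x rho : interp (Var x) rho = rho x.
Proof. by []. Qed.

Lemma interp_app M N rho :
  interp (App M N) rho = app L (interp M rho) (interp N rho).
Proof. by []. Qed.

Lemma interp_lam x M rho :
  interp (Lam x M) rho = lam L (ScottFun (interp_continuous M rho x)).
Proof. by congr (lam L _); exact: scott_funP. Qed.

Definition compact_env (rho : env D) : Prop :=
  (forall x, compact_elt (rho x)) /\ finite_set [set x | rho x <> \bot].

Definition Lambda_dec : set term :=
  [set M | forall rho, compact_env rho -> decidable_elt (interp M rho)].

End Interpretation.

(* Main.v *)
(* The interpretation of a term M in the environment y |-> d_(s y) is r.e.
   uniformly in s: by algebraicity, d_n [= fg reduces to step functions below
   the r.e. element A, and d_n [= lambda(f) to finite sets of steps below f and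
   a step function below lambda.  Hence e |-> M_rho[x:=e] is r.e. in [D -> D]
   for compact rho; the numeration of [D -> D] sends inconsistent sets of steps
   to bottom, so this also needs that inconsistency is semi-decidable, which
   holds because it is witnessed at a compact point of D.  Clause (ii) of
   effectivity then gives the case of abstractions, clause (i) that of
   applications y M_1 ... M_k. *)
Require Import Defs.
From mathcomp Require Import all_boot all_order.
From mathcomp Require Import boolp classical_sets functions cardinality.
From Stdlib Require Import PeanoNat.
From Stdlib Require Cantor.

Set Implicit Arguments.
Unset Strict Implicit.
Unset Printing Implicit Defensive.

Import Order.TTheory.
Local Open Scope classical_set_scope.

(** * Computable functions of finitely many variables *)

Definition scons (i : nat) (s : nat -> nat) : nat -> nat :=
  fun n => if n is m.+1 then s m else i.

(* Variables are de Bruijn indices into an infinite environment of which only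
   a finite part is read, which avoids all arity bookkeeping. *)
Definition computable (f : (nat -> nat) -> nat) : Prop :=
  exists N, forall k, N <= k ->
  exists2 g : k.-tuple nat -> nat,
    recursive g & forall s, f s = g [tuple s i | i < k].

Definition decidable_pred (P : (nat -> nat) -> Prop) : Prop :=
  computable (fun s => nat_of_bool `[< P s >]).

Definition semidecidable (P : (nat -> nat) -> Prop) : Prop :=
  exists2 R : nat -> (nat -> nat) -> Prop,
    decidable_pred (fun s => R (s 0) (fun n => s n.+1)) &
    forall s, P s <-> exists w, R w s.

Section Computable.
Implicit Types (f g a b c : (nat -> nat) -> nat) (P Q : (nat -> nat) -> Prop).

Lemma recursive_nth k i : recursive (fun v : k.-tuple nat => nth 0 v i).
Proof.
have [ik|ki] := ltnP i k.
  rewrite (_ : (fun v => _) = (fun v => tnth v (Ordinal ik))).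
    exact: rec_proj.
  by apply/funext => v; rewrite (tnth_nth 0).
rewrite (_ : (fun v => _) = (fun=> 0)); first exact: rec_zero.
by apply/funext => v; rewrite nth_default // size_tuple.
Qed.

Lemma nth_tuple_env k (s : nat -> nat) i : i < k ->
  nth 0 [tuple s i | i < k] i = s i.
Proof. by move=> ik; rewrite -(tnth_nth 0 _ (Ordinal ik)) tnth_mktuple. Qed.

(** One arity suffices: composition with projections turns [g] into a function of any larger number
    of variables. *)
Lemma computableI k f (g : k.-tuple nat -> nat) :
  recursive g -> (forall s, f s = g [tuple s i | i < k]) -> computable f.
Proof.
move=> rg fg; exists k => m km.
exists (fun v : m.-tuple nat => g [tuple nth 0 v i | i < k]).
  by apply: (rec_comp (g := fun i v => nth 0 v i)) => // i; exact: recursive_nth.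
move=> s; rewrite fg; congr g; apply: eq_from_tnth => i.
by rewrite !tnth_mktuple nth_tuple_env // (leq_trans _ km).
Qed.

Lemma recursive_subst k f (e : nat -> k.-tuple nat -> nat) :
  computable f -> (forall i, recursive (e i)) ->
  recursive (fun v => f (e^~ v)).
Proof.
move=> [N /(_ N (leqnn N)) [g rg fg]] re.
rewrite (_ : (fun v => _) = (fun v => g [tuple e i v | i < N])).
  by apply: (rec_comp (g := fun i : 'I_N => e i)).
by apply/funext => v; rewrite fg.
Qed.

Lemma computable_recursive k (g : k.-tuple nat -> nat) :
  recursive g -> computable (fun s => g [tuple s i | i < k]).
Proof. by move/computableI; apply. Qed.

Lemma computable_var i : computable (fun s => s i).
Proof.
apply: (computableI (recursive_nth i.+1 i)) => s.
by rewrite nth_tuple_env.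
Qed.

Lemma computable_subst f (e : nat -> (nat -> nat) -> nat) :
  computable f -> (forall i, computable (e i)) ->
  computable (fun s => f (e^~ s)).
Proof.
move=> [N /(_ N (leqnn N)) [g rg fg]] /choice[Ne ce].
(* [f] reads only the variables below [N], so only finitely many of the bounds chosen for the [e i]
   have to be dominated. *)
exists (\max_(i < N) Ne i) => k Nk.
have /choice[h hP] : forall i : 'I_N, exists h : k.-tuple nat -> nat,
    recursive h /\ forall s, e i s = h [tuple s i | i < k].
  move=> i; have [|h rh eh] := ce i k; last by exists h.
  by apply: leq_trans Nk; exact: (leq_bigmax (F := fun i : 'I_N => Ne i)).
exists (fun v => g [tuple h i v | i < N]).
  by apply: rec_comp => // i; have [] := hP i.
move=> s; rewrite fg; congr g; apply: eq_from_tnth => i.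
by rewrite !tnth_mktuple; have [_ ->] := hP i.
Qed.

Lemma computable_subst1 (h : nat -> nat) a :
  computable (fun s => h (s 0)) -> computable a -> computable (fun s => h (a s)).
Proof. by move=> ch ca; apply: (computable_subst (e := fun=> a) ch). Qed.

Lemma computable_subst2 (h : nat -> nat -> nat) a b :
  computable (fun s => h (s 0) (s 1)) -> computable a -> computable b ->
  computable (fun s => h (a s) (b s)).
Proof.
move=> ch ca cb.
by apply: (computable_subst (e := fun i => if i is 0 then a else b) ch) => -[].
Qed.

Lemma computable_scons f a :
  computable f -> computable a -> computable (fun s => f (scons (a s) s)).
Proof.
move=> cf ca; have := @computable_subst f
  (fun i s => if i is m.+1 then s m else a s) cf.
rewrite (_ : (fun s => f _) = (fun s => f (scons (a s) s))); last first.
  by apply/funext => s; congr f; apply/funext => -[].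
by apply => -[//|i]; exact: computable_var.
Qed.

Lemma computable_succ a : computable a -> computable (fun s => (a s).+1).
Proof.
apply: (computable_subst1 (h := S)).
apply: (computableI rec_succ) => s.
by rewrite /thead tnth_mktuple.
Qed.

Lemma computable_const (n : nat) : computable (fun=> n).
Proof.
elim: n => [|n]; last exact: computable_succ.
exact: (computableI (rec_zero 0)).
Qed.

Lemma computable_rec f (g : nat -> nat -> (nat -> nat) -> nat) b :
  computable f ->
  computable (fun s => g (s 0) (s 1) (fun n => s n.+2)) -> computable b ->
  computable (fun s => nat_rec (fun=> nat) (f s) (fun n r => g n r s) (b s)).
Proof.
move=> [Nf cf] [Ng cg] cb; pose k := maxn Nf Ng.
have [|f' rf fE] := cf k; first exact: leq_maxl.
have [|g' rg gE] := cg k.+2; first by rewrite !leqW // leq_maxr.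
(* [rec_prim] recurses on its first argument: the bound becomes variable 0 and the parameters are
   shifted by one. *)
apply: (@computable_scons (fun s => nat_rec (fun=> nat) (f (fun n => s n.+1))
  (fun n r => g n r (fun n => s n.+1)) (s 0)) b) cb.
apply: (computableI (rec_prim rf rg)) => s.
rewrite /thead tnth_mktuple.
have -> : [tuple of behead [tuple s i | i < k.+1]] = [tuple s i.+1 | i < k].
  apply: eq_from_tnth => i; rewrite (tnth_nth 0) /= nth_behead nth_tuple_env.
    by rewrite tnth_mktuple.
  by rewrite ltnS.
elim: (s 0) => [|n IH] /=; first exact: fE.
set r := nat_rec _ _ _ n; rewrite -{}IH.
rewrite (gE (scons n (scons r (fun n => s n.+1)))) /=; congr g'.
apply: eq_from_tnth => -[[|[|i]] ik]; rewrite tnth_mktuple // !(tnth_nth 0) //=.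
by rewrite nth_behead; exact/esym/(nth_tuple_env s (ik : i.+1 < k.+1)).
Qed.

(** Primitive recursion on the truth value of [P]: 0 gives the base value [b], 1 performs one step,
    which returns [a]. *)
Lemma computable_if P a b :
  decidable_pred P -> computable a -> computable b ->
  computable (fun s => if `[< P s >] then a s else b s).
Proof.
move=> dP ca cb; have := computable_rec cb (g := fun _ _ => a)
  (computable_subst (e := fun i s => s i.+2) ca (fun i => computable_var _)) dP.
by congr computable; apply/funext => s; case: asboolP.
Qed.

Lemma decidable_pred_eq P Q : (forall s, P s <-> Q s) ->
  decidable_pred P -> decidable_pred Q.
Proof. by move=> PQ; rewrite (_ : P = Q) //; apply/funext => s; apply/propext. Qed.

Lemma decidable_pred_bool (p : (nat -> nat) -> bool) :
  decidable_pred p <-> computable (fun s => p s).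
Proof. by rewrite /decidable_pred; under eq_fun do rewrite asboolb. Qed.

Lemma decidable_pred_subst P (e : nat -> (nat -> nat) -> nat) :
  decidable_pred P -> (forall i, computable (e i)) ->
  decidable_pred (fun s => P (e^~ s)).
Proof. exact: computable_subst. Qed.

Lemma decidable_pred_not P : decidable_pred P -> decidable_pred (fun s => ~ P s).
Proof.
move=> dP; have := computable_if dP (computable_const 0) (computable_const 1).
by congr computable; apply/funext => s; rewrite asbool_neg; case: asbool.
Qed.

Lemma decidable_pred_and P Q : decidable_pred P -> decidable_pred Q ->
  decidable_pred (fun s => P s /\ Q s).
Proof.
move=> dP dQ; have := computable_if dP dQ (computable_const 0).
by congr computable; apply/funext => s; rewrite asbool_and; case: asbool.
Qed.

Lemma decidable_pred_or P Q : decidable_pred P -> decidable_pred Q ->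
  decidable_pred (fun s => P s \/ Q s).
Proof.
move=> dP dQ; have := computable_if dP (computable_const 1) dQ.
by congr computable; apply/funext => s; rewrite asbool_or; case: asbool.
Qed.

(** The comparison says that the truncated difference vanishes; predecessor, subtraction and zero
    test are successive primitive recursions. *)
Lemma decidable_pred_le a b : computable a -> computable b ->
  decidable_pred (fun s => a s <= b s).
Proof.
have cpred : computable (fun s => (s 0).-1).
  have := computable_rec (g := fun n _ _ => n) (computable_const 0)
    (computable_var 0) (computable_var 0).
  by congr computable; apply/funext => s; case: (s 0).
have csub : computable (fun s => s 0 - s 1).
  have := computable_rec (g := fun _ r _ => r.-1) (computable_var 0)
    (computable_subst1 (h := predn) cpred (computable_var 1)) (computable_var 1).
  congr computable; apply/funext => s; elim: (s 1) => [|n /= ->]; first by rewrite subn0.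
  by rewrite subnS.
move=> ca cb; apply/decidable_pred_bool.
have := computable_rec (g := fun _ _ _ => 0) (computable_const 1) (computable_const 0)
  (computable_subst2 (h := subn) csub ca cb).
by congr computable; apply/funext => s; rewrite /leq; case: (_ - _).
Qed.

Lemma decidable_pred_lt a b : computable a -> computable b ->
  decidable_pred (fun s => a s < b s).
Proof. by move=> ca; apply: decidable_pred_le; exact: computable_succ. Qed.

Lemma decidable_pred_eqn a b : computable a -> computable b ->
  decidable_pred (fun s => a s = b s).
Proof.
move=> ca cb; apply: decidable_pred_eq
  (decidable_pred_and (decidable_pred_le ca cb) (decidable_pred_le cb ca)) => s.
by split=> [[ab ba]|->//]; apply/eqP; rewrite eqn_leq ab.
Qed.

(** * Minimization and bounded quantifiers *)

Lemma computable_min (R : nat -> (nat -> nat) -> Prop) :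
  (forall s, exists n, R n s) ->
  decidable_pred (fun s => R (s 0) (fun n => s n.+1)) ->
  exists2 f, computable f &
    forall s, R (f s) s /\ forall n, R n s -> f s <= n.
Proof.
(* [rec_min] searches for zeros, hence the characteristic function of the negation; arity [N.+1]
   leaves the first argument to the number sought. *)
move=> tR /decidable_pred_not[N cg]; have [g rg gE] := cg _ (leqnSn N).
have gP (v : N.-tuple nat) s n : (forall i, i < N -> nth 0 v i = s i) ->
    (g [tuple of n :: v] == 0) = `[< R n s >].
  move=> vs; have -> : [tuple of n :: v] = [tuple scons n s i | i < N.+1].
    by apply: eq_from_tnth => -[[|i] iN]; rewrite tnth_mktuple (tnth_nth 0) //= vs.
  by rewrite -gE /= asbool_neg; case: asbool.
(* Regularity concerns every tuple; extended by zeros, a tuple is an environment, to which the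
   totality of [R] applies. *)
have reg (v : N.-tuple nat) : exists n, g [tuple of n :: v] == 0.
  by have [n Rn] := tR (nth 0 v); exists n; rewrite (gP _ (nth 0 v)) //; apply/asboolP.
have cf := computable_recursive (rec_min reg rg).
eexists; first exact: cf.
move=> s /=; case: ex_minnP => n.
have gs m := gP [tuple s i | i < N] s m (@nth_tuple_env N s).
rewrite gs => /asboolP Rn min; split=> // m /asboolP Rm.
by apply: min; rewrite gs.
Qed.

(** The value is found by search, being the only number the graph relates to the input. This yields
    the inverses of the pairing function. *)
Lemma computable_graph f :
  decidable_pred (fun s => s 0 = f (fun n => s n.+1)) -> computable f.
Proof.
move=> df; have [|h ch hE] := computable_min (R := fun n s => n = f s) _ df.
  by move=> s; exists (f s).
by rewrite (_ : f = h) //; apply/funext => s; have [-> _] := hE s.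
Qed.

(** Minimizing over [R n s \/ b s <= n] is a total search, since [b s] is an answer; the result is
    below [b s] exactly when some witness is. *)
Lemma decidable_pred_exists_lt (R : nat -> (nat -> nat) -> Prop) b :
  decidable_pred (fun s => R (s 0) (fun n => s n.+1)) -> computable b ->
  decidable_pred (fun s => exists2 i, i < b s & R i s).
Proof.
move=> dR cb; pose T n s := R n s \/ b s <= n.
have [s|//=|f cf fE] := @computable_min T.
- by exists (b s); right.
- apply: decidable_pred_or => //; apply: decidable_pred_le; last exact: computable_var.
  by apply: (computable_subst (e := fun i s => s i.+1)) => // i; exact: computable_var.
apply: decidable_pred_eq (decidable_pred_lt cf cb) => s.
have [Tf min] := fE s; split=> [fb|[i ib Ri]].
  by exists (f s) => //; case: Tf => //; rewrite leqNgt fb.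
by apply: leq_ltn_trans ib; apply: min; left.
Qed.

Lemma decidable_pred_forall_lt (R : nat -> (nat -> nat) -> Prop) b :
  decidable_pred (fun s => R (s 0) (fun n => s n.+1)) -> computable b ->
  decidable_pred (fun s => forall i, i < b s -> R i s).
Proof.
move=> /decidable_pred_not dR cb.
apply: decidable_pred_eq (decidable_pred_not
  (decidable_pred_exists_lt (R := fun i s => ~ R i s) dR cb)) => s.
split=> [nR i ib|aR [i ib]]; last by apply; exact: aR.
by apply: contrapT => nRi; apply: nR; exists i.
Qed.

(** * Semidecidable predicates and their closure properties *)

Lemma semidecidable_eq P Q : (forall s, P s <-> Q s) ->
  semidecidable P -> semidecidable Q.
Proof. by move=> PQ; rewrite (_ : P = Q) //; apply/funext => s; apply/propext. Qed.

Lemma decidable_semidecidable P : decidable_pred P -> semidecidable P.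
Proof.
move=> dP; exists (fun _ => P).
  by apply: decidable_pred_subst dP _ => i; exact: computable_var.
by move=> s; split=> [|[]] //; exists 0.
Qed.

Lemma semidecidable_subst P (e : nat -> (nat -> nat) -> nat) :
  semidecidable P -> (forall i, computable (e i)) ->
  semidecidable (fun s => P (e^~ s)).
Proof.
move=> [R dR PR] ce; exists (fun w s => R w (e^~ s)) => [|s]; last exact: PR.
apply: (decidable_pred_subst
  (e := fun i s => if i is m.+1 then e m (fun n => s n.+1) else s 0) dR).
case=> [|i]; first exact: computable_var.
by apply: computable_subst => // n; exact: computable_var.
Qed.

(* Witness bounds are cumulative, so that several existential quantifiers can
   be merged into one without any pairing function. *)
Lemma semidecidable_bound P : semidecidable P ->
  exists2 R : nat -> (nat -> nat) -> Prop,
    decidable_pred (fun s => R (s 0) (fun n => s n.+1)) &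
    (forall s, P s <-> exists w, R w s) /\
    (forall s w w', w <= w' -> R w s -> R w' s).
Proof.
move=> [R dR PR]; exists (fun w s => exists2 i, i < w & R i s).
  apply: (decidable_pred_exists_lt (R := fun i s => R i (fun n => s n.+1)));
    last exact: computable_var.
  apply: (decidable_pred_subst (e := fun i s => if i is m.+1 then s m.+2 else s 0) dR).
  by case=> [|i]; exact: computable_var.
split=> [s|s w w' ww' [i iw Ri]]; last by exists i => //; exact: leq_trans ww'.
rewrite PR; split=> [[w Rw]|[w [i _ Ri]]]; last by exists i.
by exists w.+1, w.
Qed.

Lemma semidecidable_and P Q : semidecidable P -> semidecidable Q ->
  semidecidable (fun s => P s /\ Q s).
Proof.
move=> /semidecidable_bound[R dR [PR mR]] /semidecidable_bound[S dS [QS mS]].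
exists (fun w s => R w s /\ S w s) => [|s]; first exact: decidable_pred_and.
rewrite PR QS; split=> [[[w Rw] [w' Sw']]|[w [Rw Sw]]]; last by split; exists w.
exists (maxn w w'); split; [apply: mR Rw|apply: mS Sw'].
  exact: leq_maxl.
exact: leq_maxr.
Qed.

Lemma semidecidable_or P Q : semidecidable P -> semidecidable Q ->
  semidecidable (fun s => P s \/ Q s).
Proof.
move=> [R dR PR] [S dS QS].
exists (fun w s => R w s \/ S w s) => [|s]; first exact: decidable_pred_or.
rewrite PR QS; split=> [[[w Rw]|[w Sw]]|[w [Rw|Sw]]].
- by exists w; left.
- by exists w; right.
- by left; exists w.
- by right; exists w.
Qed.

Lemma semidecidable_exists (P : nat -> (nat -> nat) -> Prop) :
  semidecidable (fun s => P (s 0) (fun n => s n.+1)) ->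
  semidecidable (fun s => exists i, P i s).
Proof.
move=> /semidecidable_bound[R dR [PR mR]].
(* The single bound [w] serves both for [i] and for the witness of [P i]. *)
exists (fun w s => exists2 i, i < w & R w (scons i s)).
  apply: (decidable_pred_exists_lt
    (R := fun i s => R (s 0) (scons i (fun n => s n.+1)))); last exact: computable_var.
  apply: decidable_pred_eq (decidable_pred_subst
    (* The number [i] is variable 0 and [w] is variable 1, whereas [R] expects [w] first: the two
       are swapped. *)
    (e := fun i s => match i with 0 => s 1 | 1 => s 0 | m => s m end) dR _) => [s|].
    by rewrite (_ : (fun n => _) = scons (s 0) (fun n => s n.+2)) //; apply/funext => -[].
  by case=> [|[|i]]; exact: computable_var.
move=> s; split=> [[i Pi]|[w [i _ Ri]]].
  have /PR[w Rw] : (fun s => P (s 0) (fun n => s n.+1)) (scons i s) by [].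
  exists (maxn w i.+1), i; first by rewrite leq_max leqnn orbT.
  by apply: mR Rw; exact: leq_maxl.
by exists i; apply: (PR (scons i s)).2; exists w.
Qed.

Lemma semidecidable_forall_lt (P : nat -> (nat -> nat) -> Prop) b :
  semidecidable (fun s => P (s 0) (fun n => s n.+1)) -> computable b ->
  semidecidable (fun s => forall i, i < b s -> P i s).
Proof.
move=> /semidecidable_bound[R dR [PR mR]] cb.
exists (fun w s => forall i, i < b s -> R w (scons i s)).
  apply: (decidable_pred_forall_lt (b := fun s => b (fun n => s n.+1))
    (R := fun i s => R (s 0) (scons i (fun n => s n.+1)))); last first.
    by apply: computable_subst cb _ => n; exact: computable_var.
  apply: decidable_pred_eq (decidable_pred_subst
    (e := fun i s => match i with 0 => s 1 | 1 => s 0 | m => s m end) dR _) => [s|].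
    by rewrite (_ : (fun n => _) = scons (s 0) (fun n => s n.+2)) //; apply/funext => -[].
  by case=> [|[|i]]; exact: computable_var.
move=> s; split=> [|[w Rw] i ib]; last first.
  by apply: (PR (scons i s)).2; exists w; exact: Rw.
(* A witness common to all [i] below the bound: the witness bounds being cumulative, a maximum is
   taken at each step. *)
elim: (b s) => [|c IH] Pc; first by exists 0.
have [i ic|w Rw] := IH; first by apply: Pc; exact: leqW.
have /PR[w' Rw'] : (fun s => P (s 0) (fun n => s n.+1)) (scons c s) by exact: Pc.
exists (maxn w w') => i; rewrite ltnS leq_eqVlt => /predU1P[->|ic].
  by apply: mR Rw'; exact: leq_maxr.
by apply: mR (Rw i ic); exact: leq_maxl.
Qed.

(** * Transfer between functions of tuples and functions of environments *)

Lemma computable_recursive1 (h : nat -> nat) :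
  computable (fun s => h (s 0)) <-> recursive (fun v : 1.-tuple nat => h (thead v)).
Proof.
split=> [ch|/computableI]; last by apply=> s; rewrite /thead tnth_mktuple.
by apply: (recursive_subst (e := fun _ v => thead v) ch) => _; exact: rec_proj.
Qed.

Lemma decidable_relP k (P : set (k.-tuple nat)) :
  decidable_rel P -> decidable_pred (fun s => P [tuple s i | i < k]).
Proof. exact: computable_recursive. Qed.

Lemma decidable2P (P : nat -> nat -> Prop) a b :
  decidable2 P -> computable a -> computable b ->
  decidable_pred (fun s => P (a s) (b s)).
Proof.
move=> dP ca cb.
have dP' : decidable_pred (fun s => P (s 0) (s 1)).
  by apply: decidable_pred_eq (decidable_relP dP) => s; rewrite /= !nth_tuple_env.
by apply: (decidable_pred_subst (e := fun i => if i is 0 then a else b) dP') => -[].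
Qed.

Lemma decidable3P (P : nat -> nat -> nat -> Prop) a b c :
  decidable3 P -> computable a -> computable b -> computable c ->
  decidable_pred (fun s => P (a s) (b s) (c s)).
Proof.
move=> dP ca cb cc.
have dP' : decidable_pred (fun s => P (s 0) (s 1) (s 2)).
  by apply: decidable_pred_eq (decidable_relP dP) => s; rewrite /= !nth_tuple_env.
apply: (decidable_pred_subst
  (e := fun i => match i with 0 => a | 1 => b | _ => c end) dP').
by case=> [|[]].
Qed.

Lemma decidable1P (P : nat -> Prop) :
  decidable_pred (fun s => P (s 0)) -> decidable1 P.
Proof.
move/(computable_recursive1 (fun n => nat_of_bool `[< P n >])).
by congr recursive; apply/funext => v /=; rewrite /thead (tnth_nth 0).
Qed.

End Computable.

(** * Cantor pairing, binary digits and r.e. sets *)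

Lemma computable_add a b : computable a -> computable b ->
  computable (fun s => a s + b s).
Proof.
apply: computable_subst2; have := computable_rec (g := fun _ r _ => r.+1)
  (computable_var 1) (computable_succ (computable_var 1)) (computable_var 0).
by congr computable; apply/funext => s; elim: (s 0) => //= n ->.
Qed.

(** The code of [(x, y)] is [y] plus the triangular number of index [y + x], which is computed by
    primitive recursion. *)
Lemma computable_pair a b : computable a -> computable b ->
  computable (fun s => Cantor.to_nat (a s, b s)).
Proof.
apply: (computable_subst2 (h := fun x y => Cantor.to_nat (x, y))).
apply: computable_add (computable_var 1) _.
apply: (computable_rec (g := fun i m _ => i.+1 + m) (computable_const 0)).
  by apply: computable_add (computable_var 1); apply/computable_succ/computable_var.
by apply: computable_add; exact: computable_var.
Qed.

(** The graph is decidable because a pair's code bounds its components, so the missing second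
    component is sought up to the code itself. *)
Lemma computable_unpair1 a : computable a ->
  computable (fun s => (Cantor.of_nat (a s)).1).
Proof.
apply: (computable_subst1 (h := fun z => (Cantor.of_nat z).1)).
apply: computable_graph; apply: decidable_pred_eq (decidable_pred_exists_lt
  (R := fun k s => Cantor.to_nat (s 0, k) = s 1) (b := fun s => (s 1).+1) _ _).
- move=> s; split=> [[k _ <-]|->]; first by rewrite Cantor.cancel_of_to.
  exists (Cantor.of_nat (s 1)).2; last by rewrite -surjective_pairing Cantor.cancel_to_of.
  rewrite ltnS; apply/ssrnat.leP.
  have := Cantor.to_nat_non_decreasing (Cantor.of_nat (s 1)).1 (Cantor.of_nat (s 1)).2.
  rewrite -surjective_pairing Cantor.cancel_to_of; exact/Nat.le_trans/Nat.le_add_r.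
- by apply: decidable_pred_eqn (computable_var 2); apply: computable_pair; exact: computable_var.
- exact/computable_succ/computable_var.
Qed.

Lemma computable_unpair2 a : computable a ->
  computable (fun s => (Cantor.of_nat (a s)).2).
Proof.
apply: (computable_subst1 (h := fun z => (Cantor.of_nat z).2)).
apply: computable_graph; apply: decidable_pred_eq
  (decidable_pred_eqn (computable_pair
     (computable_unpair1 (computable_var 1)) (computable_var 0)) (computable_var 1)) => s.
split=> [/(congr1 Cantor.of_nat)|->]; last by rewrite -surjective_pairing Cantor.cancel_to_of.
by rewrite Cantor.cancel_of_to => <-.
Qed.

Lemma computable_pow2 a : computable a -> computable (fun s => Nat.pow 2 (a s)).
Proof.
apply: (computable_subst1 (h := Nat.pow 2)).
have := computable_rec (g := fun _ r _ => r + r) (computable_const 1)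
  (computable_add (computable_var 1) (computable_var 1)) (computable_var 0).
congr computable; apply/funext => s; elim: (s 0) => //= n ->.
by rewrite Nat.add_0_r.
Qed.

(** Digit [y] of [x] is the parity of [x] halved [y] times; halving is a recursion that adds the
    parity of the predecessor. *)
Lemma computable_testbit a b : computable a -> computable b ->
  computable (fun s => Nat.testbit (a s) (b s)).
Proof.
have codd : computable (fun s => Nat.odd (s 0)).
  have := computable_if (decidable_pred_eqn (computable_var 1) (computable_const 0))
    (computable_const 1) (computable_const 0).
  move=> /(computable_rec (g := fun _ r _ => if `[< r = 0 >] then 1 else 0)
    (computable_const 0)).
  move=> /(_ _ (computable_var 0)).
  congr computable; apply/funext => s; elim: (s 0) => // n /= ->.
  rewrite Nat.odd_succ -Nat.negb_odd; case: (Nat.odd n) => /=.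
    by case: asboolP.
  by case: asboolP.
have chalf : computable (fun s => Nat.div2 (s 0)).
  have := computable_rec (g := fun n r _ => r + Nat.odd n) (computable_const 0)
    (computable_add (computable_var 1) codd) (computable_var 0).
  congr computable; apply/funext => s; elim: (s 0) => // n /= ->.
  (* Two consecutive values are treated together because [Nat.div2] descends by two. *)
  suff [] : Nat.div2 n.+1 = Nat.div2 n + Nat.odd n /\
            Nat.div2 n.+2 = Nat.div2 n.+1 + Nat.odd n.+1 by [].
  elim: n => [//|n [IH1 IH2]]; split=> //.
  by rewrite -[RHS]/((Nat.div2 n + Nat.odd n).+1) -IH1.
apply: (computable_subst2 (h := fun x y => nat_of_bool (Nat.testbit x y))).
have := computable_subst1 (h := fun x => nat_of_bool (Nat.odd x)) codd
  (computable_rec (g := fun _ r _ => Nat.div2 r) (computable_var 0)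
    (computable_subst1 (h := Nat.div2) chalf (computable_var 1)) (computable_var 1)).
congr computable; apply/funext => s; congr nat_of_bool; elim: (s 1) (s 0) => // n IH m /=.
by rewrite -IH; congr Nat.odd; elim: n {IH} => //= n <-.
Qed.

(** From an enumeration, a witness is a preimage; conversely, all pairs of a witness and a candidate
    are enumerated. *)
Lemma re_setP (A : set nat) : re_set A <-> semidecidable (fun s => A (s 0)).
Proof.
split=> [[->|[f rf ->]]|[R dR AR]].
- exists (fun _ _ => False) => [|s]; last by split=> // -[].
  by have := computable_const 0; congr computable; apply/funext => s; rewrite asboolF.
- exists (fun w s => f w = s 0) => [|s]; last first.
    by split=> [[w _ <-]|[w <-]]; exists w.
  apply: decidable_pred_eqn (computable_var 1).
  exact/(computable_recursive1 f).
(* Membership in [A] reads only variable 0, so a constant environment can be used. *)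
have AE n : A n <-> exists w, R w (fun=> n) by exact: AR.
have [->|/set0P[a Aa]] := eqVneq A set0; [by left|right].
(* A pair whose witness fails is sent to the fixed element [a] of [A]. *)
pose g z := let w := (Cantor.of_nat z).1 in let n := (Cantor.of_nat z).2 in
  if `[< R w (fun=> n) >] then n else a.
exists g.
  apply/(computable_recursive1 g); apply: computable_if.
  - apply: (decidable_pred_subst (e := fun i s => if i is 0 then
      (Cantor.of_nat (s 0)).1 else (Cantor.of_nat (s 0)).2) dR).
    case=> [|i]; first exact/computable_unpair1/computable_var.
    exact/computable_unpair2/computable_var.
  - exact/computable_unpair2/computable_var.
  - exact: computable_const.
apply/seteqP; split=> [n /AE[w Rw]|_ [z _ <-]].
  exists (Cantor.to_nat (w, n)) => //; rewrite /g Cantor.cancel_of_to /=.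
  by case: asboolP.
by rewrite /g; case: asboolP => // Rz; apply/AE; eexists; exact: Rz.
Qed.

Local Open Scope order_scope.

(** * Effective domains and their function spaces *)

Section NumberedDomain.
Context {d : Order.disp_t} {D : numScottDomainType d}.

Lemma compact_num (c : D) : compact_elt c -> exists n, num n = c.
Proof.
move=> cc; have : range (num : nat -> D) c by rewrite range_num.
by move=> [n _ <-]; exists n.
Qed.

Definition num_bot : nat := sval (cid (compact_num compact_bot)).

Lemma num_botE : num num_bot = \bot :> D.
Proof. by rewrite /num_bot; case: cid. Qed.

(** By algebraicity and continuity, [f x] is the directed join of the values of [f] at compact
    elements below [x]; compactness of [num n] selects one of them. *)
Lemma num_approx {d'} {E : numScottDomainType d'} (f : D -> E) x n :
  scott_continuous f ->
  (num n <= f x <-> exists j, num j <= x /\ num n <= f (num j)).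
Proof.
move=> cf; split=> [nfx|[j [jx nfj]]]; last first.
  exact: le_trans nfj (scott_mono cf jx).
have [dx lx] := algebraic x.
have [_ [c [cc cx] <-] nfc] :=
  num_compact (directed_image (scott_mono cf) dx) (cf _ _ dx lx) nfx.
by have [j jc] := compact_num cc; exists j; rewrite jc.
Qed.

(** Directedness of the compact elements below [x] gives one that passes the same finitely many
    tests as [x]; this moves questions about step functions to compact points. *)
Lemma finite_approx (x : D) (k : nat -> nat) n : exists u, num u <= x /\
  forall i, (i < n)%N -> num (k i) <= x -> num (k i) <= num u :> D.
Proof.
have [[[c [cc cx]] dx] _] := algebraic x.
elim: n => [|n [u [ux uP]]]; first by have [u uc] := compact_num cc; exists u; rewrite uc.
have [kx|nkx] := boolP (num (k n) <= x); last first.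
  exists u; split=> // i; rewrite ltnS leq_eqVlt => /predU1P[->|/uP//].
  by rewrite (negbTE nkx).
have [z [[cz zx] uz kz]] := dx _ _ (conj (@num_compact _ D u) ux)
  (conj (@num_compact _ D (k n)) kx).
have [w wz] := compact_num cz; exists w; rewrite wz; split=> // i.
by rewrite ltnS leq_eqVlt => /predU1P[->//|/uP iu /iu /le_trans]; apply.
Qed.

End NumberedDomain.

Section EffectiveDomain.
Context {d : Order.disp_t} {D : effDomainType d}.
Implicit Types a b : (nat -> nat) -> nat.

Local Notation num := (num : nat -> D).

Lemma decidable_pred_ub2 a b : computable a -> computable b ->
  decidable_pred (fun s => has_ubound [set num (a s); num (b s)]).
Proof. exact: decidable2P decidable_ub. Qed.

Lemma decidable_pred_join a b c : computable a -> computable b -> computable c ->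
  decidable_pred (fun s => isLub [set num (a s); num (b s)] (num (c s))).
Proof. by move=> ca cb cc; exact: decidable3P decidable_join cc ca cb. Qed.

(** An element lies below another iff the latter is the join of both, so the order inherits
    decidability from joins. *)
Lemma decidable_pred_num_le a b : computable a -> computable b ->
  decidable_pred (fun s => num (a s) <= num (b s)).
Proof.
move=> ca cb; apply: decidable_pred_eq (decidable_pred_join cb ca cb) => s.
split=> [[+ _]|ab]; first by apply; right.
by split=> [_ [->|->]//|x]; apply; left.
Qed.

Lemma computable_join : exists2 j : nat -> nat -> nat,
  computable (fun s => j (s 0) (s 1)) &
  forall m k, has_ubound [set num m; num k] ->
    isLub [set num m; num k] (num (j m k)).
Proof.
(* The first disjunct makes the search total: for an inconsistent pair any index is accepted. *)
have [s|/=|f cf fE] := @computable_min (fun n s =>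
    ~ has_ubound [set num (s 0); num (s 1)] \/
    isLub [set num (s 0); num (s 1)] (num n)).
- have [bs|] := pselect (has_ubound [set num (s 0); num (s 1)]); last by exists 0; left.
  have [x lx] := bounded_complete _ bs.
  (* The join of two compact elements is compact, hence it has a number. *)
  have [|n nx] := @compact_num _ _ x; last by exists n; right; rewrite nx.
  have sE : [set num (s 0); num (s 1)] = [set` [:: num (s 0); num (s 1)]].
    apply/seteqP; split=> y /=; rewrite !inE; first by move=> [->|->]; rewrite eqxx ?orbT.
    by move=> /orP[/eqP|/eqP]; [left|right].
  rewrite sE in lx; apply: compact_lub lx => // y.
  by rewrite !inE => /orP[]/eqP ->; exact: num_compact.
- apply: decidable_pred_or; first apply: decidable_pred_not.
    by apply: decidable_pred_ub2; exact: computable_var.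
  by apply: decidable_pred_join; exact: computable_var.
pose e i m k : nat := if i is 0 then m else k.
exists (fun m k => f (fun i => e i m k)) => [|m k bmk].
  apply: (computable_subst (e := fun i s => e i (s 0) (s 1)) cf).
  by case=> [|i]; exact: computable_var.
by have [[]] := fE (fun i => e i m k).
Qed.

(* The joins of the successive initial segments are computed without testing
   whether they exist: the family is bounded iff the last value obtained is an
   upper bound. *)
Lemma decidable_pred_bounded (K : nat -> (nat -> nat) -> nat) b :
  computable (fun s => K (s 0) (fun n => s n.+1)) -> computable b ->
  decidable_pred (fun s => has_ubound [set num (K i s) | i in [set i | (i < b s)%N]]).
Proof.
move=> cK cb; have [j cj jE] := computable_join.
pose p s n := nat_rec (fun=> nat) (@num_bot _ D) (fun i r => j r (K i s)) n.
have cp : computable (fun s => p s (b s)).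
  apply: (computable_rec (g := fun i r s => j r (K i s)) (computable_const _)) => //.
  apply: computable_subst2 cj (computable_var 1) _.
  apply: (computable_subst (e := fun i s => if i is n.+1 then s n.+2 else s 0) cK).
  by case=> [|i]; exact: computable_var.
have : decidable_pred (fun s => forall i, (i < b s)%N -> num (K i s) <= num (p s (b s))).
  apply: (decidable_pred_forall_lt (R := fun i s => num (K i s) <= num (p s (b s)))) => //.
  apply: decidable_pred_num_le => //.
  by apply: computable_subst cp _ => i; exact: computable_var.
apply: decidable_pred_eq => s; split=> [le_p|[x ub]].
  by exists (num (p s (b s))) => _ [i /le_p + <-].
have inv n : (n <= b s)%N -> num (p s n) <= x /\
    forall i, (i < n)%N -> num (K i s) <= num (p s n).
  elim: n => [|n IH] nb; first by rewrite /p /= num_botE; split=> //; exact: le0x.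
  have [px Kp] := IH (ltnW nb).
  have [|u l] := jE (p s n) (K n s).
    by exists x => _ [->//|->]; apply: ub; exists n.
  split=> [|i]; first by apply: l => _ [->//|->]; apply: ub; exists n.
  rewrite ltnS leq_eqVlt => /predU1P[->|/Kp iK]; first by apply: u; right.
  by apply: le_trans iK _; apply: u; left.
exact: (inv _ (leqnn _)).2.
Qed.

End EffectiveDomain.

Lemma testbit_lt j i : Nat.testbit j i -> (i < j)%N.
Proof.
move=> ji; rewrite ltnNge; apply/negP => /ssrnat.leP ij.
have j0 : j <> 0 by move=> j0; rewrite j0 Nat.bits_0 in ji.
suff : Nat.testbit j i = false by rewrite ji.
by apply/Nat.bits_above_log2/(Nat.lt_le_trans _ j) => //; apply/Nat.log2_lt_lin/Nat.neq_0_lt_0.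
Qed.

(** * Codes of finite sets of step functions *)

Section FunctionSpaceCoding.
Context {d d' : Order.disp_t} {D : numScottDomainType d} {E : numScottDomainType d'}.
Implicit Types f : {scott D -> E}.

Local Notation steps := (@step_set _ _ D E).

(** A power of 2 has a single digit 1, so this is the canonical index of the set whose only element
    is the pair [(m, n)]. *)
Definition step_code m n : nat := Nat.pow 2 (Cantor.to_nat (m, n)).

Lemma step_set_ubound j f : ubound (steps j) f <->
  forall i, (i < j)%N -> Nat.testbit j i ->
    num (Cantor.of_nat i).2 <= f (num (Cantor.of_nat i).1).
Proof.
split=> [ub i _ ji|le_f _ [i ji <-]]; first by apply/step_leP/ub; exists i.
by apply/step_leP/le_f => //; exact: testbit_lt.
Qed.

Lemma step_set_code m n : steps (step_code m n) = [set step m n].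
Proof.
apply/seteqP; split=> [_ [i /= + <-]|_ ->] /=.
  by rewrite Nat.pow2_bits_eqb => /Nat.eqb_eq <-; rewrite Cantor.cancel_of_to.
by exists (Cantor.to_nat (m, n)); [exact: Nat.pow2_bits_true|rewrite Cantor.cancel_of_to].
Qed.

Lemma num_step_code m n f : num (step_code m n) <= f <-> num n <= f (num m).
Proof.
have [|u l] := @scott_num_lub _ _ D E (step_code m n) (step m n).
  by rewrite step_set_code => _ ->.
rewrite -step_leP; split=> [|mn].
  by apply: le_trans; apply: u; rewrite step_set_code.
by apply: l; rewrite step_set_code => _ ->.
Qed.

(** Inconsistent codes denote bottom and so lie below every function; this is why inconsistency has
    to be detected for [f] to be r.e. *)
Lemma scott_num_le j f :
  scott_num j <= f <-> ~ has_ubound (steps j) \/ ubound (steps j) f.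
Proof.
have [bj|nbj] := pselect (has_ubound (steps j)); last first.
  by rewrite scott_num_unbounded //; split=> _; [left|exact: le0x].
split=> [jf|[//|jf]]; last by have [_] := scott_num_lub jf; apply.
right=> g jg; apply: le_trans jf; case: bj => h /scott_num_lub[u _]; exact: u.
Qed.

(** Joins of functions are pointwise, so consistency can be tested on values. Steps that are
    inactive at [num u] contribute bottom, which does not affect boundedness. *)
Lemma step_set_bounded j : has_ubound (steps j) <->
  forall u, has_ubound
    [set (num (if Nat.testbit j i && (num (Cantor.of_nat i).1 <= (num u : D))
               then (Cantor.of_nat i).2 else @num_bot _ E) : E) |
      i in [set i | (i < j)%N]].
Proof.
split=> [[f /step_set_ubound jf] u|bj].
  exists (f (num u)) => _ [i ij <-]; case: andP => [[ji iu]|_].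
    by apply: le_trans (jf i ij ji) _; exact: scott_mono (scott_fun_continuous f) _ _ iu.
  by rewrite num_botE le0x.
have [|h [uh _] _] := @scott_lub _ _ _ _ (steps j); last by exists h.
move=> x; apply: bounded_complete.
(* Every step active at [x] is active at the compact point [num u], so a bound for the values there
   also works at [x]. *)
have [u [ux uP]] := finite_approx x (fun i => (Cantor.of_nat i).1) j.
have [y uby] := bj u; exists y => _ [_ [i /= ji <-] <-] /=; rewrite /step_val.
case: ifPn => [ix|_]; last exact: le0x.
have ij := testbit_lt ji.
by apply: uby; exists i => //; rewrite ji uP.
Qed.

(** With [ubound] in place of the order, the approximation of [f] becomes a finite list of
    inequalities, free of the inconsistent case. *)
Lemma num_approx_fun {d''} {X : numScottDomainType d''} (F : {scott D -> E} -> X) f n :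
  scott_continuous F ->
  (num n <= F f <-> exists j, ubound (steps j) f /\ num n <= F (num j)).
Proof.
move=> cF; rewrite (num_approx f n cF).
split=> -[j [jf nF]]; last first.
  by exists j; split=> //; apply/scott_num_le; right.
have /scott_num_le[nbj|ubj] := jf; last by exists j.
(* An inconsistent [j] denotes bottom, so 0, the code of the empty set, can replace it. *)
exists 0; split; first by move=> g [i /=]; rewrite Nat.bits_0.
apply: le_trans nF (scott_mono cF _).
by rewrite [num j](scott_num_unbounded nbj) le0x.
Qed.

End FunctionSpaceCoding.

Lemma computable_step_code a b : computable a -> computable b ->
  computable (fun s => step_code (a s) (b s)).
Proof. by move=> ca cb; exact/computable_pow2/computable_pair. Qed.

Lemma semidecidable_re_set A a : re_set A -> computable a ->
  semidecidable (fun s => A (a s)).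
Proof.
by move=> /re_setP rA ca; apply: (semidecidable_subst (e := fun=> a) rA).
Qed.

Lemma semidecidable_step_set {d d'} {D : numScottDomainType d}
    {E : numScottDomainType d'} (f : (nat -> nat) -> {scott D -> E}) :
  semidecidable (fun s => num (s 0) <= f (fun n => s n.+2) (num (s 1))) ->
  semidecidable (fun s => ubound (step_set (s 0)) (f (fun n => s n.+1))).
Proof.
(* Semidecidability is not preserved by implication in general; the premise is a decidable digit
   test, so its negation can enter a disjunction. *)
move=> sf; pose P i s := ~ Nat.testbit (s 0) i \/
  num (Cantor.of_nat i).2 <= f (fun n => s n.+1) (num (Cantor.of_nat i).1).
apply: (@semidecidable_eq (fun s => forall i, (i < s 0)%N -> P i s)) => [s|].
  rewrite step_set_ubound; split=> H i ij; first by move=> ji; case: (H i ij).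
  by have [/(H i ij)|nji] := boolP (Nat.testbit (s 0) i); [right|left; exact/negP].
apply: semidecidable_forall_lt; last exact: computable_var.
apply: semidecidable_or.
  apply/decidable_semidecidable/decidable_pred_not/decidable_pred_bool.
  by apply: computable_testbit; exact: computable_var.
apply: (semidecidable_subst (e := fun i s => match i with
  | 0 => (Cantor.of_nat (s 0)).2 | 1 => (Cantor.of_nat (s 0)).1 | m => s m end) sf).
case=> [|[|i]]; last exact: computable_var.
  exact/computable_unpair2/computable_var.
exact/computable_unpair1/computable_var.
Qed.

(** * R.e. elements of the function space *)

Section EffectiveFunctionSpace.
Context {d d' : Order.disp_t} {D : effDomainType d} {E : effDomainType d'}.

(** Inconsistency shows at some compact point [num u], where boundedness of the finitely many values
    is decidable; what remains is a search for [u]. *)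
Lemma semidecidable_step_set_unbounded :
  semidecidable (fun s => ~ has_ubound (@step_set _ _ D E (s 0))).
Proof.
pose K s i u := if Nat.testbit (s 0) i && (num (Cantor.of_nat i).1 <= (num u : D))
  then (Cantor.of_nat i).2 else @num_bot _ E.
apply: (@semidecidable_eq (fun s => exists u, ~ has_ubound
  [set (num (K s i u) : E) | i in [set i | (i < s 0)%N]])) => [s|].
  by rewrite step_set_bounded -existsNP.
apply/semidecidable_exists/decidable_semidecidable/decidable_pred_not.
apply: (decidable_pred_bounded (K := fun i s => K (fun n => s n.+1) i (s 0)));
  last exact: computable_var.
have := @computable_if (fun s => Nat.testbit (s 2) (s 0) /\
  num (Cantor.of_nat (s 0)).1 <= (num (s 1) : D)) (fun s => (Cantor.of_nat (s 0)).2)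
  (fun=> @num_bot _ E).
rewrite (_ : (fun s => if _ then _ else _) = fun s => K (fun n => s n.+2) (s 0) (s 1)).
  apply.
  - apply: decidable_pred_and.
      by apply/decidable_pred_bool/computable_testbit; exact: computable_var.
    apply: decidable_pred_num_le; last exact: computable_var.
    exact/computable_unpair1/computable_var.
  - exact/computable_unpair2/computable_var.
  - exact: computable_const.
by apply/funext => s; rewrite /K asbool_and !asboolb.
Qed.

Lemma re_elt_scott (f : {scott D -> E}) :
  semidecidable (fun s => num (s 0) <= f (num (s 1))) -> re_elt f.
Proof.
move=> sf; apply/re_setP; apply: semidecidable_eq
  (semidecidable_or semidecidable_step_set_unbounded
    (semidecidable_step_set (f := fun=> f) sf)) => s.
exact: iff_sym (scott_num_le _ _).
Qed.

End EffectiveFunctionSpace.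

(** * Effective models *)

Section EffectiveModel.
Context {d : Order.disp_t} {D : effDomainType d} (L : weakly_effective_model D).

Definition abs M (rho : env D) x : {scott D -> D} :=
  ScottFun (interp_continuous L M rho x).

(** Every environment with compact values has this form; the codes of the values become variables of
    the semidecidable predicates. *)
Definition num_env (s : nat -> nat) : env D := fun y => num (s y).

Lemma upd_num_env s x m :
  upd (num_env s) x (num m) = num_env (fun y => if y == x then m else s y).
Proof. by apply/funext => y; rewrite /upd /num_env; case: ifP. Qed.

Lemma semidecidable_abs M x :
  semidecidable (fun s => num (s 0) <= interp L M (num_env (fun n => s n.+1))) ->
  semidecidable (fun s => num (s 0) <= abs M (num_env (fun n => s n.+2)) x (num (s 1))).
Proof.
move=> sM; apply: semidecidable_eq (semidecidable_subst
  (e := fun i s => if i is y.+1 then if y == x then s 1 else s y.+2 else s 0) sM _).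
  by move=> s; have <- := upd_num_env (fun n => s n.+2) x (s 1).
by case=> [|y]; [|case: (y == x)]; exact: computable_var.
Qed.

(** The argument is approximated first, by [b]; then [step b n] is a compact element below
    [app L f], and approximating [f] by [a] leaves one step function below [app L]. *)
Lemma num_le_app n (f g : D) : num n <= app L f g <->
  exists b a, [/\ num b <= g, num a <= f & num (step_code a (step_code b n)) <= app L].
Proof.
split.
  move=> /(num_approx _ _ (scott_fun_continuous (app L f)))[b [bg]].
  move=> /num_step_code/(num_approx _ _ (scott_fun_continuous (app L)))[a [af]].
  by move=> le_n; exists b, a; split=> //; exact/num_step_code.
move=> [b [a [bg af /num_step_code/num_step_code le_n]]].
apply/(num_approx _ _ (scott_fun_continuous (app L f))); exists b; split=> //.
apply: le_trans le_n _; apply: scott_le_app.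
exact: scott_mono (scott_fun_continuous (app L)) _ _ af.
Qed.

Lemma num_le_lam n (f : {scott D -> D}) : num n <= lam L f <->
  exists j, ubound (step_set j) f /\ num (step_code j n) <= lam L.
Proof.
apply: iff_trans (num_approx_fun _ _ (scott_fun_continuous (lam L))) _.
by split=> -[j [jf jn]]; exists j; split=> //; exact/num_step_code.
Qed.

Lemma semidecidable_interp M :
  semidecidable (fun s => num (s 0) <= interp L M (num_env (fun n => s n.+1))).
Proof.
elim: M => [x|M IHM N IHN|x M IHM].
- apply/decidable_semidecidable/decidable_pred_num_le; exact: computable_var.
- apply: (@semidecidable_eq (fun s => exists b a,
    num b <= interp L N (num_env (fun n => s n.+1)) /\
    (num a <= interp L M (num_env (fun n => s n.+1)) /\
     num (step_code a (step_code b (s 0))) <= app L))) => [s|].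
    rewrite interp_app num_le_app; split=> -[b [a]].
      by move=> [? [? ?]]; exists b, a.
    by move=> [? ? ?]; exists b, a.
  (* Variables are now [a], [b], [n] in this order, and the environment starts at index 3. *)
  do 2 apply: semidecidable_exists.
  apply: semidecidable_and; [|apply: semidecidable_and].
  + apply: (semidecidable_subst (e := fun i s => if i is y.+1 then s y.+3 else s 1) IHN).
    by case=> [|i]; exact: computable_var.
  + apply: (semidecidable_subst (e := fun i s => if i is y.+1 then s y.+3 else s 0) IHM).
    by case=> [|i]; exact: computable_var.
  + apply: (semidecidable_re_set (app_re L)).
    by apply: computable_step_code; [|apply: computable_step_code]; exact: computable_var.
- apply: (@semidecidable_eq (fun s => exists j,
    ubound (step_set j) (abs M (num_env (fun n => s n.+1)) x) /\
    num (step_code j (s 0)) <= lam L)) => [s|].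
    by rewrite interp_lam num_le_lam.
  apply/semidecidable_exists/semidecidable_and.
    apply: (semidecidable_subst (e := fun i s => if i is y.+1 then s y.+2 else s 0)
      (semidecidable_step_set (f := fun s => abs M (num_env s) x)
         (semidecidable_abs x IHM))).
    by case=> [|i]; exact: computable_var.
  apply: (semidecidable_re_set (lam_re L)).
  by apply: computable_step_code; exact: computable_var.
Qed.

Lemma re_elt_abs M rho x : compact_env rho -> re_elt (abs M rho x).
Proof.
move=> [crho _]; have /choice[t tE] := fun y => compact_num (crho y).
have -> : rho = num_env t by apply/funext => y; rewrite /num_env tE.
apply: re_elt_scott.
(* The codes [t] come from choice and need not form a computable sequence: finitely many of them are
   read, each as a constant. *)
apply: (semidecidable_subst (e := fun i s =>
  match i with 0 => s 0 | 1 => s 1 | y.+2 => t y end)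
  (semidecidable_abs x (semidecidable_interp M))).
by case=> [|[|i]]; [exact: computable_var..|exact: computable_const].
Qed.

Lemma compact_decidable_elt (c : D) : compact_elt c -> decidable_elt c.
Proof.
move=> /compact_num[n <-]; apply: decidable1P.
by apply: decidable_pred_num_le; [exact: computable_var|exact: computable_const].
Qed.

Lemma compact_env_upd (rho : env D) x e :
  compact_env rho -> compact_elt e -> compact_env (upd rho x e).
Proof.
move=> [crho frho] ce; split=> [y|]; first by rewrite /upd; case: ifP.
apply: (@sub_finite_set _ _ ([set y | rho y <> \bot] `|` [set x])).
  by move=> y; rewrite /= /upd; case: eqVneq => [->|_]; [right|left].
by rewrite finite_setU.
Qed.

Lemma interp_foldl_App M (s : seq term) rho :
  interp L (foldl App M s) rho =
  foldl (fun a b => app L a b) (interp L M rho) [seq interp L N rho | N <- s].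
Proof. by elim: s M => //= N s IH M; rewrite IH interp_app. Qed.

(** * Closure properties of the decidable terms *)

Context (effL : effective_model L).

Lemma Lambda_dec_Var x : Lambda_dec L (Var x).
Proof. by move=> rho [crho _]; exact: compact_decidable_elt (crho x). Qed.

Lemma Lambda_dec_App y k (M : k.-tuple term) :
  (forall i, Lambda_dec L (tnth M i)) -> Lambda_dec L (foldl App (Var y) M).
Proof.
move=> decM rho crho; rewrite interp_foldl_App.
apply: (effL.1 _ _ [tuple of [seq interp L N rho | N <- M]]) => [|i].
  exact: crho.1.
by rewrite tnth_map; exact: decM.
Qed.

(** Clause (ii) tests the function only at compact arguments, and updating a compact environment by
    such an argument keeps it compact. *)
Lemma Lambda_dec_Lam x M : Lambda_dec L M -> Lambda_dec L (Lam x M).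
Proof.
move=> decM rho crho; rewrite interp_lam; apply: effL.2 => [|e ce].
  exact: re_elt_abs.
by apply: decM; exact: compact_env_upd.
Qed.

(* A normal form which is not an abstraction is a variable applied to normal
   forms; this has to be carried through the induction. *)
Lemma Lambda_dec_normal M : beta_normal M -> Lambda_dec L M /\
  ((exists x P, M = Lam x P) \/
   exists y k (N : k.-tuple term),
     (forall i, Lambda_dec L (tnth N i)) /\ M = foldl App (Var y) N).
Proof.
elim: M => [y|M IHM P IHP|x M IHM] nM.
- split; first exact: Lambda_dec_Var.
  by right; exists y, 0, [tuple]; split=> // -[].
- have [|_ M_app] := IHM; first by move=> x Q R sub; apply: (nM x Q R); exact: sub_appl.
  have [|decP _] := IHP; first by move=> x Q R sub; apply: (nM x Q R); exact: sub_appr.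
  case: M_app nM => [[x [Q ->]] /(_ x Q P)[]|[y [k [N [decN ->]]]] _].
    exact: Defs.sub_refl.
  have decNP i : Lambda_dec L (tnth [tuple of rcons N P] i).
    rewrite (tnth_nth P) /= nth_rcons size_tuple; case: ltnP => [ik|_].
      by have := decN (Ordinal ik); rewrite (tnth_nth P).
    by case: ifP.
  have -> : App (foldl App (Var y) N) P = foldl App (Var y) [tuple of rcons N P].
    by rewrite /= foldl_rcons.
  by split; [exact: Lambda_dec_App|right; exists y, k.+1, [tuple of rcons N P]].
- have [|decM _] := IHM; first by move=> y Q R sub; apply: (nM y Q R); exact: sub_lam.
  by split; [exact: Lambda_dec_Lam|left; exists x, M].
Qed.

End EffectiveModel.

Theorem theorem3 (d : Order.disp_t) (D : effDomainType d)
    (L : weakly_effective_model D) (effL : effective_model L) :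
  (forall x : nat, Lambda_dec L (Var x)) /\
  (forall (y k : nat) (M : k.-tuple term),
     (forall i, Lambda_dec L (tnth M i)) ->
     Lambda_dec L (foldl App (Var y) M)) /\
  (forall (x : nat) (M : term), Lambda_dec L M -> Lambda_dec L (Lam x M)) /\
  (forall M : term, beta_normal M -> Lambda_dec L M).
Proof.
split; [exact: Lambda_dec_Var|split; [|split]].
- by move=> y k M; exact: Lambda_dec_App.
- by move=> x M; exact: Lambda_dec_Lam.
- by move=> M /(Lambda_dec_normal effL)[].
Qed.
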